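(* Let $X$ be a real Banach space. The following assertions are equivalent: (1) $X$ has the strong diameter two property, i.e. every convex combination of slices of $B_X$ has diameter two. (2) For every convex combination of slices $C$ of $B_X$ and every $\varepsilon>0$, there exists $x\in C$ such that $\Vert x\Vert>1-\varepsilon$.
   Context: All Banach spaces are real. $B_X$ and $S_X$ denote the closed unit ball and the unit sphere of $X$, and $X^*$ is the topological dual. A slice of $B_X$ is a set $S(B_X,f,\alpha):=\{x\in B_X: f(x)>1-\alpha\}$ with $f\in S_{X^*}$ and $\alpha>0$. A convex combination of slices of $B_X$ is a set $\sum_{i=1}^n\lambda_i S_i$ (Minkowski sum), where $\lambda_1,\dots,\lambda_n\in[0,1]$, $\sum_{i=1}^n\lambda_i=1$, and each $S_i$ is a slice of $B_X$. *)

(* Defs.v *)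
From mathcomp Require Export all_boot all_order all_algebra.
From mathcomp Require Export all_classical all_reals all_analysis.
Import Order.TTheory GRing.Theory Num.Theory.
Import numFieldNormedType.Exports.

Set Implicit Arguments.
Unset Strict Implicit.
Unset Printing Implicit Defensive.

Local Open Scope classical_set_scope.
Local Open Scope ring_scope.

Section Slices.
Context {R : realType} {X : normedModType R}.

Definition unit_ball : set X := [set x | `|x| <= 1].

(* The dual norm. It is a real-valued supremum, so it is only meaningful when
   f is bounded on the unit ball, i.e. when f is continuous. *)
Definition dual_norm (f : X -> R^o) : R := sup [set `|f x| | x in unit_ball].

Definition dual_unit_sphere : set {linear X -> R^o} :=
  [set f | continuous f /\ dual_norm f = 1].

Definition slice (f : X -> R^o) (alpha : R) : set X :=
  [set x | unit_ball x /\ f x > 1 - alpha].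

Definition is_slice (S : set X) : Prop :=
  exists (f : {linear X -> R^o}) (alpha : R),
    [/\ dual_unit_sphere f, 0 < alpha & S = slice f alpha].

Definition weighted_minkowski_sum (n : nat) (lambda : 'I_n -> R)
    (S : 'I_n -> set X) : set X :=
  [set x | exists2 s : 'I_n -> X,
     forall i, S i (s i) & x = \sum_(i < n) lambda i *: s i].

Definition is_convex_combination_of_slices (C : set X) : Prop :=
  exists (n : nat) (lambda : 'I_n -> R) (S : 'I_n -> set X),
    [/\ forall i, 0 <= lambda i <= 1,
        \sum_(i < n) lambda i = 1,
        forall i, is_slice (S i)
      & C = weighted_minkowski_sum lambda S].

Definition diameter (A : set X) : \bar R :=
  ereal_sup [set (`|x - y|)%:E | x in A & y in A].

End Slices.

Definition strong_diameter_two_property (R : realType) (X : normedModType R)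
    : Prop :=
  forall C : set X, is_convex_combination_of_slices C -> diameter C = 2%:E.

(* Main.v *)
Require Import Defs.
Import Order.TTheory GRing.Theory Num.Theory.
Import numFieldNormedType.Exports.

Local Open Scope classical_set_scope.
Local Open Scope ring_scope.

(** Every convex combination of slices [C] lies in the unit ball, so two points
    of [C] at distance almost two both have norm almost one, by the triangle
    inequality: this gives (1) => (2). For (2) => (1), slices are stable under
    [x |-> - x], hence so are their convex combinations, and therefore the
    symmetrization [(C - C) / 2] is again a convex combination of slices
    ([half_sum_cvx_comb_slices], [opp_cvx_comb_slices]). A point of norm almost
    one in it is half the difference of two points of [C], whose distance is
    then almost two. *)

Section ConvexCombinationsOfSlices.
Context {R : realType} {X : normedModType R}.
Implicit Types (S C D : set X) (x y : X).

Lemma opp_slice S : is_slice S -> is_slice [set - x | x in S].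
Proof.
move=> [f [alpha [[fcont fnorm] alpha_gt0 ->]]].
exists (\- f : {linear X -> R^o}), alpha; split=> //.
  split; first by move=> x; apply: cvgN; exact: fcont.
  rewrite -fnorm /dual_norm; congr sup.
  by apply: eq_imagel => x _ /=; rewrite normrN.
apply/seteqP; split=> [_ [x [xB fx] <-]|x [xB fx]].
  by split; rewrite /unit_ball /= ?normrN// linearN opprK.
exists (- x); rewrite ?opprK//.
by split; rewrite /unit_ball /= ?normrN// linearN.
Qed.

Lemma opp_cvx_comb_slices C : is_convex_combination_of_slices C ->
  is_convex_combination_of_slices [set - x | x in C].
Proof.
move=> [n [lambda [S [lambda01 lambda1 sliceS ->]]]].
exists n, lambda, (fun i => [set - x | x in S i]); split=> //.
  by move=> i; exact: opp_slice.
apply/seteqP; split=> [_ [_ [s Ss ->] <-]|_ [s Ss ->]].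
  exists (fun i => - s i); first by move=> i; exists (s i).
  by rewrite -sumrN; apply: eq_bigr => i _; rewrite scalerN.
exists (\sum_(i < n) lambda i *: - s i).
  exists (fun i => - s i) => // i.
  by have [x Sx <-] := Ss i; rewrite opprK.
by rewrite -sumrN; apply: eq_bigr => i _; rewrite scalerN opprK.
Qed.

(** The two families of slices are concatenated and all the weights halved. *)
Lemma half_sum_cvx_comb_slices C D : is_convex_combination_of_slices C ->
  is_convex_combination_of_slices D ->
  is_convex_combination_of_slices [set 2^-1 *: (x + y) | x in C & y in D].
Proof.
move=> [m [lambda [S [lambda01 lambda1 sliceS ->]]]].
move=> [n [mu [T [mu01 mu1 sliceT ->]]]].
pose glue (A : Type) (u : 'I_m -> A) (v : 'I_n -> A) (i : 'I_(m + n)) :=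
  match fintype.split i with inl j => u j | inr k => v k end.
have glueL A u v j : glue A u v (lshift n j) = u j.
  by rewrite /glue (unsplitK (inl _ j)).
have glueR A u v k : glue A u v (rshift m k) = v k.
  by rewrite /glue (unsplitK (inr _ k)).
have half01 (a : R) : 0 <= a <= 1 -> 0 <= 2^-1 * a <= 1.
  move=> /andP[a0 a1]; rewrite mulr_ge0 ?invr_ge0//=.
  by rewrite mulr_ile1// ?invr_ge0// invf_le1// ler1n.
exists (m + n)%N, (fun i => 2^-1 * glue R lambda mu i), (glue _ S T); split.
- by move=> i; apply: half01; rewrite /glue; case: fintype.split.
- rewrite -mulr_sumr big_split_ord /=.
  under eq_bigr do rewrite glueL.
  under [X in _ + X]eq_bigr do rewrite glueR.
  by rewrite lambda1 mu1 mulVf// pnatr_eq0.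
- by move=> i; rewrite /glue; case: fintype.split.
apply/seteqP; split=> [_ [_ [s Ss ->] [_ [t Tt ->] <-]]|_ [r Sr ->]].
  exists (glue X s t); first by move=> i; rewrite /glue; case: fintype.split.
  rewrite big_split_ord scalerDr !scaler_sumr /=; congr (_ + _).
    by apply: eq_bigr => i _; rewrite !glueL scalerA.
  by apply: eq_bigr => i _; rewrite !glueR scalerA.
exists (\sum_(i < m) lambda i *: r (lshift n i)).
  by exists (r \o lshift n) => // i; have := Sr (lshift n i); rewrite glueL.
exists (\sum_(i < n) mu i *: r (rshift m i)).
  by exists (r \o @rshift m n) => // i; have := Sr (rshift m i); rewrite glueR.
rewrite big_split_ord scalerDr !scaler_sumr /=; congr (_ + _).
  by apply: eq_bigr => i _; rewrite !glueL scalerA.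
by apply: eq_bigr => i _; rewrite !glueR scalerA.
Qed.

Lemma cvx_comb_slices_sub_ball C :
  is_convex_combination_of_slices C -> C `<=` unit_ball.
Proof.
move=> [n [lambda [S [lambda01 lambda1 sliceS ->]]]] _ [s Ss ->].
rewrite /unit_ball /= (le_trans (ler_norm_sum _ _ _))// -lambda1.
apply: ler_sum => i _; have /andP[lambda0 _] := lambda01 i.
rewrite normrZ ger0_norm// ler_piMr//.
by have [f [alpha [_ _ Si]]] := sliceS i; have := Ss i; rewrite Si => -[].
Qed.

Lemma diameter_eq2P C : C `<=` unit_ball ->
  diameter C = 2%:E <->
  forall eps : R, 0 < eps -> exists x y, [/\ C x, C y & 2 - eps < `|x - y|].
Proof.
move=> CB; split=> [diamC eps eps0|far].
  have : ((2 - eps)%:E < diameter C)%E by rewrite diamC lte_fin gtrBl.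
  move=> /ereal_sup_gt[_ [x Cx [y Cy <-]]]; rewrite lte_fin => xy.
  by exists x, y.
apply/eqP; rewrite eq_le; apply/andP; split.
  apply: ge_ereal_sup => _ [x Cx [y Cy <-]]; rewrite lee_fin.
  by rewrite (le_trans (ler_normB _ _))// lerD//; exact: CB.
apply/lee_addgt0Pr => eps /far[x [y [Cx Cy xy]]].
rewrite -leeBlDr// -EFinB (le_trans (ltW (_ : _ < `|x - y|%:E)%E)) ?lte_fin//.
by apply: ereal_sup_ubound; exists x => //; exists y.
Qed.

End ConvexCombinationsOfSlices.

Theorem theorem3p1 (R : realType) (X : completeNormedModType R) :
  strong_diameter_two_property X <->
  (forall C : set X, is_convex_combination_of_slices C ->
   forall eps : R, 0 < eps -> exists2 x : X, C x & `|x| > 1 - eps).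
Proof.
split=> [sd2p C slC eps eps0|norming C slC].
  have CB := cvx_comb_slices_sub_ball C slC.
  have [x [y [Cx Cy xy]]] := (diameter_eq2P C CB).1 (sd2p C slC) eps eps0.
  exists x => //; have yB : `|y| <= 1 := CB y Cy.
  have : 2 - eps < `|x| + 1.
    by rewrite (lt_le_trans xy)// (le_trans (ler_normB _ _))// lerD2l.
  by rewrite -ltrBlDr addrAC -[2]/(1 + 1) addrK.
apply/(diameter_eq2P C (cvx_comb_slices_sub_ball C slC)) => eps eps0.
have eps20 : 0 < eps / 2 by rewrite divr_gt0.
have [_ [x Cx [_ [y Cy <-] <-]]] := norming _
  (half_sum_cvx_comb_slices _ _ slC (opp_cvx_comb_slices _ slC)) _ eps20.
rewrite normrZ ger0_norm ?invr_ge0// => xy; exists x, y; split=> //.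
by move: xy; rewrite [2^-1 * _]mulrC ltr_pdivlMr// mulrBl mul1r divfK ?pnatr_eq0.
Qed.
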